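(* Let $\Delta>0$, let $\mu=(\mu_1,\mu_2)\in\mathbb{R}^2$ with $|\mu_1-\mu_2|=\Delta$, and let $T\ge 1$ be an integer. If $T\Delta^2\geq 1$, then the regret of the SPRT-ETC algorithm (run with inputs $T$ and $\Delta$) is upper-bounded as $$R_\mu^{\mathrm{SPRT\text{-}ETC}}(T)\leq \frac{\log(eT\Delta^2)}{\Delta} + \frac{4\sqrt{\log(T\Delta^2)}+4}{\Delta} + \Delta .$$ Otherwise it is upper bounded by $T\Delta/2+\Delta$, and for all $T$ and $\Delta$ the regret is less than $10\sqrt{T/e} + \Delta$.
   Context: Two-armed Gaussian bandit with known integer horizon $T$: at each time $t\in\{1,\dots,T\}$ the agent chooses $A_t\in\{1,2\}$ based on past observations and receives a reward $Z_t\sim\mathcal N(\mu_{A_t},1)$, where successive rewards from each arm are i.i.d. and the two arms are independent. Expectation under $\mu$ is denoted $\mathbb{E}_\mu$. The regret of a strategy $\pi$ is $R^\pi_\mu(T) = T \max\{\mu_1, \mu_2\} - \mathbb{E}_\mu\left[\sum_{t=1}^T \mu_{A_t}\right]$. For $i\in\{1,2\}$, $\hat\mu_{i,n}$ is the empirical mean of the first $n$ rewards from arm $i$. SPRT-ETC algorithm (inputs $T$ and $\Delta$): define the stopping time $$\tau = \inf\Big\{ t=2n,\ n\ge1 : \big|\hat{\mu}_{1,n} - \hat{\mu}_{2,n} \big| \geq \frac{\log(T\Delta^2)}{n\Delta}\Big\}.$$ For $t\le\min(\tau,T)$ the algorithm plays arm $1$ if $t$ is odd and arm $2$ if $t$ is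 even; if $\tau<T$, then for $\tau<t\le T$ it plays $\hat a=\operatorname{argmax}_i\hat\mu_{i,\tau/2}$, the empirically best arm at time $\tau$. (If $T\Delta^2\le1$, the algorithm thus stops exploring after one sample from each arm.) *)

(* Defs.v *)
From HB Require Import structures.
From mathcomp Require Import all_boot all_order all_algebra.
From mathcomp Require Import all_classical all_reals all_analysis.

Set Implicit Arguments.
Unset Strict Implicit.
Unset Printing Implicit Defensive.

Import Order.TTheory GRing.Theory Num.Theory.
Local Open Scope classical_set_scope.
Local Open Scope ring_scope.

Definition arm : finType := 'I_2.
Definition arm1 : arm := ord0.
Definition arm2 : arm := ord_max.

(* Pairs (A_s, Z_s), oldest first; the index of the next round to be played
   is therefore [(size h).+1]. *)
Definition history (R : realType) : Type := seq (arm * R).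

Definition strategy (R : realType) : Type := history R -> arm.

Definition rewards_of (R : realType) (a : arm) (h : history R) : seq R :=
  [seq z.2 | z <- h & z.1 == a].

Definition mu_hat (R : realType) (a : arm) (n : nat) (h : history R) : R :=
  (\sum_(k < n) (rewards_of a h)`_k) / n%:R.

Definition mutually_independent (d : measure_display)
    (Omega : measurableType d) (R : realType) (P : probability Omega R)
    (I : eqType) (X : I -> {RV P >-> R}) : Prop :=
  forall (s : seq I) (B : I -> set R), uniq s ->
    (forall i, measurable (B i)) ->
    P (\bigcap_(i in [set` s]) (X i @^-1` B i)) =
    (\prod_(i <- s) P (X i @^-1` B i))%E.

(* [X a k] is the reward produced by the (k+1)-th pull of arm a. *)
Definition gaussian_rewards (d : measure_display)
    (Omega : measurableType d) (R : realType) (P : probability Omega R)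
    (mu : arm -> R) (X : arm -> nat -> {RV P >-> R}) : Prop :=
  (forall (a : arm) (k : nat) (B : set R), measurable B ->
     distribution P (X a k) B = normal_prob (mu a) 1 B) /\
  mutually_independent (fun i : arm * nat => X i.1 i.2).

(* The history after t rounds of [pi] played against the reward tables
   [x a] (x a k is the outcome of the (k+1)-th pull of a). *)
Fixpoint play (R : realType) (x : arm -> nat -> R) (pi : strategy R)
    (t : nat) : history R :=
  if t is t'.+1 then
    let h := play x pi t' in
    let a := pi h in
    rcons h (a, x a (size (rewards_of a h)))
  else [::].

(* The arm A_t, for 1 <= t. *)
Definition arm_at (R : realType) (x : arm -> nat -> R) (pi : strategy R)
    (t : nat) : arm :=
  pi (play x pi t.-1).

(* Extended-real valued because the library's expectation is. *)
Definition regret (d : measure_display) (Omega : measurableType d)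
    (R : realType) (P : probability Omega R) (mu : arm -> R)
    (X : arm -> nat -> {RV P >-> R}) (pi : strategy R) (T : nat) : \bar R :=
  ((T%:R * Num.max (mu arm1) (mu arm2))%:E
   - 'E_P[fun w : Omega =>
       (\sum_(1 <= t < T.+1) mu (arm_at (fun a k => X a k w) pi t))%R])%E.

Definition sprt_stops (R : realType) (T : nat) (Delta : R) (h : history R)
    (n : nat) : bool :=
  ln (T%:R * Delta ^+ 2) / (n%:R * Delta)
    <= `|mu_hat arm1 n h - mu_hat arm2 n h|.

(* [Some n] when tau = 2n <= size h, [None] when tau > size h: as long as the
   test has not stopped, the arms alternate, so that the first n rewards of
   each arm are known as soon as 2n <= size h. *)
Definition sprt_tau_half (R : realType) (T : nat) (Delta : R)
    (h : history R) : option nat :=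
  ohead [seq n <- iota 1 (size h)./2 | sprt_stops T Delta h n].

(* A tie in the argmax (a null event) is broken by the library's [arg max]. *)
Definition sprt_etc (R : realType) (T : nat) (Delta : R) : strategy R :=
  fun h =>
    if sprt_tau_half T Delta h is Some n then
      [arg max_(a > arm1) mu_hat a n h]%O
    else if odd (size h).+1 then arm1 else arm2.

(* Main.v *)
Require Import Defs.
From HB Require Import structures.
From mathcomp Require Import all_boot all_order all_algebra.
From mathcomp Require Import all_classical all_reals all_analysis.
From mathcomp Require Import measurable_realfun charge ring lra.

Set Implicit Arguments.
Unset Strict Implicit.
Unset Printing Implicit Defensive.

Import Order.TTheory GRing.Theory Num.Theory.
Local Open Scope classical_set_scope.
Local Open Scope ring_scope.

(** Let g be the better arm, b the other one, x = T Delta^2 and L = ln x, and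
    let S_n be the sum of X_{g,k} - X_{b,k} over k < n, a random walk with
    steps N(Delta, 2).  The test stops at the first n with
    |S_n| >= L / Delta.

    The regret is Delta times the expected number of pulls of b
    ([regret_pulls]).  Round t+1 pulls b either because the test has not yet
    stopped at the index t/2 and it is the turn of b, or because the test has
    stopped and has elected b.  Over all rounds the first reason contributes
    at most the sum over k of the probability that the test is still running
    at k, and the second at most T times the probability of a wrong election
    ([regret_sprt_le]).

    Both probabilities come from a single maximal inequality.  The product of
    the factors exp (s (Y - m) - s^2 / 2), one for each reward Y ~ N(m, 1), is
    a positive martingale of mean 1, so that it ever reaches c with
    probability at most 1 / c ([gaussian_maximal]).  With the tilt - theta on
    g and theta on b, it is exp (- theta (S_n - n Delta) - n theta^2) once n
    rewards of each arm have been used ([gap_maximal]).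
    - For theta = Delta this is exp (- Delta S_n), and S_n goes below
      - L / Delta with probability at most exp (- L) = 1 / x
      ([gap_ruin]).  Wrong elections thus cost Delta T / x = 1 / Delta.
    - At a single time k it is a Chernoff bound ([gap_chernoff]): if the test
      is still running at k then S_k < L / Delta, which has probability at
      most exp (kappa (t0 - k)), where kappa = theta (Delta - theta) and
      kappa t0 = theta L / Delta.  The sum of min (1, exp (kappa (t0 - k)))
      over k is at most 1 + t0 + 1 / kappa ([sum_min1_expR_le]), and
      theta = Delta / (1 + v) with v = sqrt (L + 1) turns this into
      1 + (1 + v)^2 / Delta^2 ([chernoff_optimum]).

    For x >= 1 the regret is therefore at most
    Delta + ((1 + v)^2 + 1) / Delta ([regret_sprt_log]), which is below the
    first bound of the theorem.  The third bound has to be drawn from this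
    sharper estimate, because the first one is too weak for it when L is small
    and positive (L = 1/4, say), whereas ((1 + v)^2 + 1) exp (- L / 2) is at
    most 5, its value at L = 0, and 5 < 10 / sqrt e.

    For x < 1 the threshold is negative, so that the test stops after one pull
    of each arm, and the symmetry of the Gaussian law bounds the probability
    of a wrong election by 1/2 ([first_pull_le_half]). *)

(** * Gaussian tilting and centring *)

Lemma ge0_integral_normal_prob (R : realType) (m s : R)
    (f : measurableTypeR R -> \bar R) :
  s != 0 -> measurable_fun setT f -> (forall x, (0 <= f x)%E) ->
  (\int[normal_prob m s]_x f x =
   \int[lebesgue_measure]_x (f x * (normal_pdf m s x)%:E))%E.
Proof.
move=> s0 mf f0; have dom := @normal_prob_dominates R m s.
rewrite -(Radon_Nikodym_SigmaFinite.change_of_variables dom)//=.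
apply: ae_eq_integral => //.
- apply: emeasurable_funM => //.
  apply: (measurable_int lebesgue_measure).
  exact: Radon_Nikodym_SigmaFinite.f_integrable.
- apply: emeasurable_funM => //; apply/measurableT_comp => //.
  exact: measurable_normal_pdf.
- apply: ae_eqe_mul2l.
  apply: integral_ae_eq => //.
  + exact: Radon_Nikodym_SigmaFinite.f_integrable.
  + by apply/measurableT_comp => //; exact: measurable_normal_pdf.
  + by move=> E _ mE; rewrite -Radon_Nikodym_SigmaFinite.f_integral.
Qed.

(** Tilting by exp (s (y - m) - s^2 / 2) shifts the mean of the density
    from m to m + s, and the shifted density has mass 1. *)
Lemma integral_normal_prob_tilt (R : realType) (m s : R) :
  (\int[normal_prob m 1]_y (expR (s * (y - m) - s ^+ 2 / 2))%:E = 1)%E.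
Proof.
have mf : measurable_fun [set: measurableTypeR R]
    (fun y : measurableTypeR R => (expR (s * (y - m) - s ^+ 2 / 2))%:E).
  apply/measurable_EFinP; apply: measurableT_comp => //.
  by apply: measurable_funB => //; apply: measurable_funM => //;
    apply: measurable_funB.
have f0 (y : measurableTypeR R) : (0 <= (expR (s * (y - m) - s ^+ 2 / 2))%:E)%E.
  by rewrite lee_fin expR_ge0.
rewrite (ge0_integral_normal_prob m (oner_neq0 R) mf f0).
rewrite -(integral_normal_pdf (m + s) 1); apply: eq_integral => x _.
rewrite -EFinM !normal_pdfE ?oner_neq0// mulrCA /normal_fun -expRD.
by congr (_ * expR _)%:E; field.
Qed.

(** [normal_prob] lives on the Borel structure of [measurableTypeR], the laws of
    real random variables on the default one; the two are compared by pushing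
    forward along the identity. *)
Lemma integral_normal_law_tilt (R : realType) (m s : R)
    (Q : {measure set R -> \bar R}) :
  (forall B : set R, measurable B -> Q B = normal_prob m 1 B) ->
  (\int[Q]_y (expR (s * (y - m) - s ^+ 2 / 2))%:E = 1)%E.
Proof.
move=> lawQ.
have mid : measurable_fun [set: measurableTypeR R]
    ((fun x => x) : measurableTypeR R -> R).
  by move=> _ B mB; rewrite setTI.
pose Q' : {measure set R -> \bar R} :=
  pushforward (normal_prob m 1) (HB.pack_for {mfun measurableTypeR R >-> R}
    ((fun x => x) : measurableTypeR R -> R)
    (isMeasurableFun.Build _ _ _ _ _ mid)).
rewrite (eq_measure_integral (Q' mid)) => [|B mB _]; last exact: lawQ.
rewrite /Q' ge0_integral_pushforward//.
  by rewrite preimage_setT integral_normal_prob_tilt.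
apply/measurable_EFinP; apply: measurableT_comp => //.
by apply: measurable_funB => //; apply: measurable_funM => //;
  apply: measurable_funB.
Qed.

Lemma lebesgue_measure_shift (R : realType) (c : R) (A : set R) :
  measurable A ->
  pushforward lebesgue_measure ((fun x => x + c) : _ -> measurableTypeR R) A =
  lebesgue_measure A.
Proof.
have mc : measurable_fun [set: measurableTypeR R]
    ((fun x => x + c) : _ -> measurableTypeR R) by exact: measurable_funD.
pose mfc := isMeasurableFun.Build _ _ _ _ _ mc.
pose fc : {mfun measurableTypeR R >-> measurableTypeR R} :=
  HB.pack ((fun x => x + c) : measurableTypeR R -> measurableTypeR R) mfc.
move=> mA; apply/esym.
apply: (@lebesgue_measure_unique R (pushforward lebesgue_measure fc)) => //=.
move=> _ [[a b]] _ <-.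
rewrite /pushforward.
rewrite (_ : _ @^-1` _ = `]a - c, b - c]%classic); last first.
  by apply/seteqP; split => x /=; rewrite !in_itv/= ltrBlDr lerBrDr.
rewrite !lebesgue_measure_itv/= !lte_fin ltrD2r -!EFinB.
by congr (if _ then _%:E else _); ring.
Qed.

Lemma normal_prob_center (R : realType) (m : R) (B : set R) : measurable B ->
  normal_prob m 1 [set x | B (x - m)] = normal_prob 0 1 B.
Proof.
move=> mB.
have mc : measurable_fun [set: measurableTypeR R]
    ((fun x => x + - m) : _ -> measurableTypeR R) by exact: measurable_funD.
rewrite /normal_prob.
transitivity (\int[pushforward lebesgue_measure
    ((fun x => (x + - m)%R) : _ -> measurableTypeR R)]_(x in B)
    (normal_pdf 0 1 x)%:E)%E.
  rewrite ge0_integral_pushforward//=.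
  - apply: eq_integral => x _; congr EFin.
    by rewrite !normal_pdfE ?oner_neq0// /normal_fun subr0.
  - by apply/measurable_EFinP/measurable_funTS; exact: measurable_normal_pdf.
  - by move=> x _; rewrite lee_fin normal_pdf_ge0.
by apply: eq_measure_integral => A mA _; exact: lebesgue_measure_shift.
Qed.

(** * Independence and driven recursions *)

Lemma finite_measure_prod_ext (d1 d2 : measure_display)
    (T1 : measurableType d1) (T2 : measurableType d2) (R : realType)
    (m1 m2 : {measure set (T1 * T2) -> \bar R}) :
  (m1 setT < +oo)%E ->
  (forall A B, measurable A -> measurable B -> m1 (A `*` B) = m2 (A `*` B)) ->
  forall C, measurable C -> m1 C = m2 C.
Proof.
move=> m1oo m12.
pose G : set (set (T1 * T2)) :=
  [set C | exists2 A, measurable A & exists2 B, measurable B & A `*` B = C].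
apply: (measure_unique G (fun=> setT)).
- by rewrite measurable_prod_measurableType.
- move=> _ _ [A mA [B mB <-]] [A' mA' [B' mB' <-]]; rewrite -setXI.
  exists (A `&` A'); first exact: measurableI.
  by exists (B `&` B') => //; exact: measurableI.
- by move=> _; exists setT => //; exists setT => //; rewrite setXTT.
- by rewrite -subTset => x _; exists 0%N.
- by move=> _ [A mA [B mB <-]]; exact: m12.
- by [].
Qed.

Section independence.
Context (d : measure_display) (Omega : measurableType d) (R : realType)
  (P : probability Omega R).

(** The event E is kept fixed: both sides are finite measures of C, so
    independence of E propagates from rectangles to all Borel sets of the
    plane, hence to every event that depends on the pair (U, V). *)
Lemma indep_pair_event (U V : Omega -> R) (E : set Omega) :
  measurable_fun setT U -> measurable_fun setT V -> measurable E ->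
  (forall A B, measurable A -> measurable B ->
    P (U @^-1` A `&` V @^-1` B `&` E) =
    (P (U @^-1` A `&` V @^-1` B) * P E)%E) ->
  forall C : set (R * R), measurable C ->
    P ([set w | C (U w, V w)] `&` E) = (P [set w | C (U w, V w)] * P E)%E.
Proof.
move=> mU mV mE indep.
have mUV : measurable_fun setT (fun w => (U w, V w)).
  exact: measurable_fun_pair.
pose mfc := isMeasurableFun.Build _ _ _ _ _ mUV.
pose Z : {mfun Omega >-> (R * R)%type} := HB.pack (fun w => (U w, V w)) mfc.
pose r : {nonneg R} := NngNum (fine_ge0 (measure_ge0 P E)).
have rE : r%:num%:E = P E by rewrite /r/= fineK// fin_num_measure.
pose m1 : {measure set (R * R) -> \bar R} := pushforward (mrestr P mE) Z.
pose m2 : {measure set (R * R) -> \bar R} := mscale r (pushforward P Z).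
move=> C mC.
have : m1 mUV C = m2 mUV C.
  apply: finite_measure_prod_ext => // [|A B mA mB].
  - rewrite /m1/= /pushforward/= /mrestr preimage_setT setTI.
    by rewrite -ge0_fin_numE ?measure_ge0// fin_num_measure.
  - by rewrite /m1/m2/= /mscale/= /pushforward/= /mrestr/= rE muleC -indep.
by rewrite /m1/m2/= /mscale/= /pushforward/= /mrestr/= rE muleC.
Qed.

Lemma ge0_integral_indep (U V : Omega -> R) (f : R -> R -> R) :
  measurable_fun setT U -> measurable_fun setT V ->
  (forall A B, measurable A -> measurable B ->
    P (U @^-1` A `&` V @^-1` B) = (P (U @^-1` A) * P (V @^-1` B))%E) ->
  measurable_fun setT (fun z : R * R => f z.1 z.2) ->
  (forall u v, 0 <= f u v) ->
  (\int[P]_w (f (U w) (V w))%:E =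
   \int[P]_w \int[pushforward P V]_v (f (U w) v)%:E)%E.
Proof.
move=> mU mV indep mf f0.
have mUV : measurable_fun setT (fun w => (U w, V w)).
  exact: measurable_fun_pair.
pose Z : {RV P >-> (R * R)%type} := HB.pack (fun w => (U w, V w))
  (isMeasurableFun.Build _ _ _ _ _ mUV).
pose U' : {RV P >-> R} := HB.pack U (isMeasurableFun.Build _ _ _ _ _ mU).
pose V' : {RV P >-> R} := HB.pack V (isMeasurableFun.Build _ _ _ _ _ mV).
pose g (z : R * R) := (f z.1 z.2)%:E.
have mg : measurable_fun setT g by exact/measurable_EFinP.
have g0 z : (0 <= g z)%E by rewrite lee_fin.
transitivity (\int[distribution P Z]_z g z)%E.
  by rewrite ge0_integral_distribution.
transitivity (\int[distribution P U' \x distribution P V']_z g z)%E.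
  apply: eq_measure_integral => C mC _; apply/esym.
  by apply: product_measure_unique => // A B mA mB; exact: indep.
rewrite fubini_tonelli1// ge0_integral_distribution//.
- exact: measurable_fun_fubini_tonelli_F.
- by move=> u; apply: integral_ge0 => v _; rewrite lee_fin.
Qed.

End independence.

(** A recursion driven by independent noise: the state after j steps depends on
    Y_0, ..., Y_{j-1} only.  Carrying a single real state, instead of the
    vector of all the noises, keeps every joint law on the plane. *)
Section chain.
Context (d : measure_display) (Omega : measurableType d) (R : realType)
  (P : probability Omega R) (Y : nat -> {RV P >-> R}).
Hypothesis indepY : mutually_independent Y.
Variables (phi : nat -> R -> R -> R) (u0 : R).
Hypothesis mphi : forall j, measurable_fun setT (fun z : R * R => phi j z.1 z.2).

Fixpoint chain (j : nat) (w : Omega) : R :=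
  if j is k.+1 then phi k (chain k w) (Y k w) else u0.

Lemma measurable_chain j : measurable_fun setT (chain j).
Proof.
elim: j => [|j IH] /=; first exact: measurable_cst.
apply: (measurableT_comp (mphi j) (g := fun w => (chain j w, Y j w))).
by apply: measurable_fun_pair => //.
Qed.

Definition cylinder (s : seq nat) (B : nat -> set R) : set Omega :=
  \bigcap_(i in [set` s]) (Y i @^-1` B i).

Lemma measurable_cylinder s B : (forall i, measurable (B i)) ->
  measurable (cylinder s B).
Proof.
move=> mB; apply: bigcap_measurableType => i _.
by rewrite -[_ @^-1` _]setTI; exact: measurable_funP.
Qed.

(** Induction on j: an event on the state at j+1 is an event on the pair formed
    by the state at j and Y_j.  On rectangles, Y_j joins the cylinder, so that
    the induction hypothesis applies, and [indep_pair_event] extends the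
    factorization to that pair. *)
Lemma chain_indep_future j s B A : uniq s -> {in s, forall i, (j <= i)%N} ->
  (forall i, measurable (B i)) -> measurable A ->
  P (chain j @^-1` A `&` cylinder s B) =
  (P (chain j @^-1` A) * P (cylinder s B))%E.
Proof.
move=> + + mB; elim: j s B mB A => [|j IH] s B mB A us js mA.
  have [Au0|Au0] := pselect (A u0).
    rewrite (_ : chain 0 @^-1` A = setT); last by apply/seteqP; split.
    by rewrite setTI probability_setT mul1e.
  rewrite (_ : chain 0 @^-1` A = set0); last by apply/seteqP; split.
  by rewrite set0I measure0 mul0e.
have sj : j \notin s by apply/negP => /js; rewrite ltnn.
pose B' (C : set R) i := if i == j then C else B i.
have mB' C : measurable C -> forall i, measurable (B' C i).
  by move=> mC i; rewrite /B'; case: ifP.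
have cylB' (C : set R) : cylinder (j :: s) (B' C) = Y j @^-1` C `&` cylinder s B.
  rewrite /cylinder !bigcap_seq big_cons /B' eqxx; congr (_ `&` _).
  apply: eq_big_seq => i si.
  by rewrite ifN//; apply: contraNneq sj => <-.
have js' : {in j :: s, forall i, (j <= i)%N}.
  by move=> i; rewrite inE => /predU1P[->//|/js/ltnW].
have us' : uniq (j :: s) by rewrite /= sj.
have PcylB' C : measurable C ->
    P (Y j @^-1` C `&` cylinder s B) = (P (Y j @^-1` C) * P (cylinder s B))%E.
  move=> mC; rewrite -cylB' /cylinder !indepY//; last exact: mB'.
  rewrite big_cons {1}/B' eqxx; congr (_ * _)%E.
  apply: eq_big_seq => i si.
  by rewrite /B' ifN//; apply: contraNneq sj => <-.
have cyl1 C : cylinder [:: j] (fun=> C) = Y j @^-1` C.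
  by rewrite /cylinder bigcap_seq big_seq1.
pose C : set (R * R) := [set z | A (phi j z.1 z.2)].
have mC : measurable C by rewrite -[C]setTI; exact: mphi.
apply: (indep_pair_event (U := chain j) (V := Y j) _ _ _ _ mC).
- exact: measurable_chain.
- by [].
- exact: measurable_cylinder.
move=> A1 A2 mA1 mA2; rewrite -setIA -cylB' IH//; last exact: mB'.
rewrite cylB' PcylB'// muleA; congr (_ * _)%E.
by rewrite -cyl1 IH//= => i; rewrite inE => /eqP ->.
Qed.

Lemma integral_chain_step j : (forall u v, 0 <= phi j u v) ->
  (\int[P]_w (chain j.+1 w)%:E =
   \int[P]_w \int[pushforward P (Y j)]_v (phi j (chain j w) v)%:E)%E.
Proof.
move=> phi0; rewrite /= ge0_integral_indep//; first exact: measurable_chain.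
move=> A B mA mB.
have cyl1 : cylinder [:: j] (fun=> B) = Y j @^-1` B.
  by rewrite /cylinder bigcap_seq big_seq1.
by rewrite -cyl1 chain_indep_future// => i; rewrite inE => /eqP ->.
Qed.

End chain.

Lemma mutually_independent_reindex (d : measure_display)
    (Omega : measurableType d) (R : realType) (P : probability Omega R)
    (I J : eqType) (X : I -> {RV P >-> R}) (f : J -> I) (g : I -> J) :
  cancel f g -> mutually_independent X -> mutually_independent (X \o f).
Proof.
move=> fK indep s B us mB.
have := indep (map f s) (B \o g) _ (fun i => mB (g i)).
rewrite map_inj_uniq ?us; last exact: can_inj fK.
move=> /(_ isT); rewrite big_map => e.
rewrite (_ : \bigcap_(i in _) _ =
   \bigcap_(i in [set` map f s]) (X i @^-1` (B \o g) i)).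
  by rewrite e; apply: eq_bigr => i _ /=; rewrite fK.
apply/seteqP; split => w /= wB i /=.
  by move=> /mapP[j sj ->]; rewrite fK; exact: wB.
by move=> si; have := wB (f i) (map_f f si); rewrite /= fK.
Qed.

(** * Maximal inequality and symmetry for Gaussian rewards *)

Section maximal.
Context (d : measure_display) (Omega : measurableType d) (R : realType)
  (P : probability Omega R) (Y : nat -> {RV P >-> R}).
Hypothesis indepY : mutually_independent Y.
Variables (m s : nat -> R).
Hypothesis lawY : forall i (B : set R), measurable B ->
  distribution P (Y i) B = normal_prob (m i) 1 B.

Definition log_tilt (n : nat) (w : Omega) : R :=
  \sum_(i < n) (s i * (Y i w - m i) - s i ^+ 2 / 2).

(** The process exp (log_tilt) is frozen as soon as it reaches c.  Each step of
    the frozen process has conditional mean equal to its current value, by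
    [integral_normal_law_tilt], so its mean stays 1; and at time n it is at
    least c on A.  Markov's inequality concludes. *)
Lemma gaussian_maximal (c : R) (n : nat) (A : set Omega) : 0 < c ->
  measurable A ->
  (forall w, A w -> exists2 j, (j <= n)%N & c <= expR (log_tilt j w)) ->
  (P A <= (c^-1)%:E)%E.
Proof.
move=> c0 mA Ac.
(* The absolute value makes phi nonnegative for every u; it changes nothing
   along the chain, whose states are nonnegative. *)
pose phi (j : nat) (u y : R) : R :=
  if c <= u then u else `|u| * expR (s j * (y - m j) - s j ^+ 2 / 2).
have mphi j : measurable_fun setT (fun z : R * R => phi j z.1 z.2).
  apply: measurable_fun_ifT.
  - by apply: measurable_fun_ler => //.
  - by [].
  - apply: measurable_funM; first exact: measurableT_comp.
    apply: measurableT_comp => //; apply: measurable_funB => //; apply: measurable_funM => //.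
    by apply: measurable_funB.
pose U := chain Y phi 1.
have mU j : measurable_fun setT (U j) by exact: measurable_chain.
have U0 j w : 0 <= U j w.
  elim: j => [|j IH] /=; rewrite ?ler01//.
  by rewrite /phi; case: ifP => // _; rewrite mulr_ge0 ?expR_ge0.
have EU j : (\int[P]_w (U j w)%:E = 1)%E.
  elim: j => [|j IH]; first by rewrite /= integral_cst//= probability_setT mule1.
  rewrite integral_chain_step//; last first.
    move=> u v; rewrite /phi; case: ifP => [cu|_].
      exact/ltW/(lt_le_trans c0).
    by rewrite mulr_ge0 ?expR_ge0.
  rewrite -IH; apply: eq_integral => w _.
  rewrite -/U; move: (U j w) (U0 j w) => u u_ge0.
  rewrite /phi; case: (boolP (c <= u)) => cu.
    by rewrite integral_cst//= /pushforward preimage_setT probability_setT mule1.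
  rewrite ger0_norm//.
  under eq_integral do rewrite EFinM.
  rewrite ge0_integralZl//; last first.
    apply/measurable_EFinP; apply: measurableT_comp => //.
    by apply: measurable_funB => //; apply: measurable_funM => //;
      apply: measurable_funB.
  by rewrite integral_normal_law_tilt ?mule1//; exact: lawY.
(* Before the level c is reached, freezing has no effect. *)
have UL j w : (forall i, (i < j)%N -> expR (log_tilt i w) < c) ->
    U j w = expR (log_tilt j w).
  elim: j => [|j IH] Hj; first by rewrite /log_tilt big_ord0 expR0.
  rewrite /= -/U IH => [|i ij]; last exact/Hj/ltnW.
  by rewrite /phi leNgt Hj//= ger0_norm ?expR_ge0// -expRD /log_tilt big_ord_recr.
have Uc j w : c <= expR (log_tilt j w) -> exists2 i, (i <= j)%N & c <= U i w.
  move=> cj; pose Q i := c <= expR (log_tilt i w).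
  have exQ : exists i, Q i by exists j.
  case: (ex_minnP exQ) => i Qi minQ; exists i; first exact: minQ.
  rewrite UL// => k ki; rewrite ltNge; apply/negP => /minQ.
  by rewrite leqNgt ki.
have Uup i j w : c <= U i w -> (i <= j)%N -> c <= U j w.
  move=> cU; elim: j => [|j IH]; first by rewrite leqn0 => /eqP <-.
  rewrite leq_eqVlt => /predU1P[<-//|/IH cUj].
  by rewrite /= -/U /phi cUj.
have AU : A `<=` [set w | c <= U n w].
  move=> w /Ac[j jn /Uc[i ij ci]]; apply: Uup ci _; exact: leq_trans ij jn.
have mcU : measurable [set w | c <= U n w].
  have := measurable_fun_ler (measurable_cst c) (mU n).
  by move/(_ measurableT [set true] I); rewrite setTI.
apply: (@le_trans _ _ (P [set w | c <= U n w])).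
  by rewrite le_measure ?inE.
pose U' : {RV P >-> R} := HB.pack (U n) (isMeasurableFun.Build _ _ _ _ _ (mU n)).
have mid : measurable_fun [set: R] (@id R) by [].
have := @markov _ _ _ P U' id c c0 mid (fun _ r0 => r0)
  (fun _ _ _ _ xy => xy).
rewrite unlock /=.
under eq_integral do rewrite ger0_norm//.
rewrite EU (_ : [set _ | _] = [set w | c <= U n w]); last first.
  by apply/seteqP; split => w /=; rewrite lee_fin ger0_norm.
by rewrite -lee_pdivlMl// mule1.
Qed.

End maximal.

(** The centred variables xi = U - m1 and eta = V - m2 are exchangeable, and
    U <= V forces xi < eta, which is as likely as eta < xi and disjoint from
    it. *)
Lemma normal_prob_le_half (d : measure_display) (Omega : measurableType d)
    (R : realType) (P : probability Omega R) (U V : {RV P >-> R}) (m1 m2 : R) :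
  m2 < m1 ->
  (forall B : set R, measurable B -> P (U @^-1` B) = normal_prob m1 1 B) ->
  (forall B : set R, measurable B -> P (V @^-1` B) = normal_prob m2 1 B) ->
  (forall A B, measurable A -> measurable B ->
    P (U @^-1` A `&` V @^-1` B) = (P (U @^-1` A) * P (V @^-1` B))%E) ->
  (P [set w | (U w <= V w)%R] <= (2^-1)%:E)%E.
Proof.
move=> m21 lawU lawV indep.
pose xi w := U w - m1; pose eta w := V w - m2.
have mxi : measurable_fun setT xi by apply: measurable_funB.
have meta : measurable_fun setT eta by apply: measurable_funB.
have mcenter (m : R) (B : set R) :
    measurable B -> measurable [set x | B (x - m)].
  move=> mB; rewrite -[X in measurable X]setTI.
  by apply: (measurable_funB _ _ measurableT mB).
have joint A B : measurable A -> measurable B ->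
    P (xi @^-1` A `&` eta @^-1` B) = (normal_prob 0 1 A * normal_prob 0 1 B)%E.
  move=> mA mB; rewrite -(normal_prob_center m1 mA) -(normal_prob_center m2 mB).
  rewrite -(lawU _ (mcenter m1 _ mA)) -(lawV _ (mcenter m2 _ mB)).
  by rewrite -(indep _ _ (mcenter m1 _ mA) (mcenter m2 _ mB)).
have mZ1 : measurable_fun setT (fun w => (xi w, eta w)).
  exact: measurable_fun_pair.
have mZ2 : measurable_fun setT (fun w => (eta w, xi w)).
  exact: measurable_fun_pair.
pose Z1 : {mfun Omega >-> (R * R)%type} := HB.pack (fun w => (xi w, eta w))
  (isMeasurableFun.Build _ _ _ _ _ mZ1).
pose Z2 : {mfun Omega >-> (R * R)%type} := HB.pack (fun w => (eta w, xi w))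
  (isMeasurableFun.Build _ _ _ _ _ mZ2).
pose H : set (R * R) := [set z | z.1 < z.2].
have mH : measurable H.
  rewrite -[H]setTI (_ : H = (fun z : R * R => z.1 < z.2) @^-1` [set true])//.
  exact: (measurable_fun_ltr measurable_fst measurable_snd).
have swap : distribution P Z1 H = distribution P Z2 H.
  apply: (@finite_measure_prod_ext _ _ _ _ _ (distribution P Z1)
    (distribution P Z2)) => //.
    by rewrite -ge0_fin_numE ?measure_ge0// fin_num_measure.
  move=> A B mA mB.
  rewrite /distribution /pushforward/= -[LHS]/(P (xi @^-1` A `&` eta @^-1` B)).
  rewrite -[RHS]/(P (eta @^-1` A `&` xi @^-1` B)) joint// setIC joint//.
  by rewrite muleC.
pose L := [set w | xi w < eta w]; pose G := [set w | eta w < xi w].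
have mL : measurable L by exact: (measurable_funPTI Z1 mH).
have mG : measurable G by exact: (measurable_funPTI Z2 mH).
have LG : P L = P G by exact: swap.
have : (P L + P L <= 1)%E.
  rewrite {2}LG -measureU//; first exact: probability_le1 (measurableU _ _ mL mG).
  by apply/seteqP; split => w //= [] /lt_trans h /h; rewrite ltxx.
have : (P [set w | (U w <= V w)%R] <= P L)%E.
  rewrite le_measure ?inE//.
    have := measurable_fun_ler (measurable_funPT U) (measurable_funPT V).
    by move/(_ measurableT [set true] I); rewrite setTI.
  by move=> w /= UV; rewrite /L/= /xi /eta; lra.
rewrite -(fineK (fin_num_measure P _ mL)) => PL PLL.
apply: (le_trans PL); rewrite lee_fin.
by move: PLL; rewrite -EFinD lee_fin; lra.
Qed.

(** * The gap walk of the two arms *)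

Definition other (a : arm) : arm := if a == arm1 then arm2 else arm1.

Lemma armP (a : arm) : a = arm1 \/ a = arm2.
Proof. by case: a => -[|[|//]] i; [left|right]; exact: val_inj. Qed.

Lemma other_neq a : other a != a.
Proof. by case: (armP a) => ->. Qed.

Lemma arm_other (g a : arm) : (a == other g) = (a != g).
Proof. by case: (armP a) => ->; case: (armP g) => ->. Qed.

(** The arm played in round t+1 of the exploration phase. *)
Definition turn (t : nat) : arm := if odd t then arm2 else arm1.

Lemma turn_double k g : (turn k.*2 == g) = (turn k.*2.+1 != g).
Proof. by rewrite /turn/= odd_double; case: (armP g) => ->. Qed.

Section gap.
Context (d : measure_display) (Omega : measurableType d) (R : realType)
  (P : probability Omega R) (mu : arm -> R) (X : arm -> nat -> {RV P >-> R}).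
Hypothesis hX : gaussian_rewards mu X.
Variable g : arm.
Local Notation b := (other g).
Local Notation Delta := (mu g - mu b).

Definition gap (n : nat) (w : Omega) : R := \sum_(k < n) (X g k w - X b k w).

(* The rewards in the order of the exploration phase; n rewards of each arm are
   the first n.*2 terms of this single independent sequence. *)
Let Y i := X (turn i) i./2.
Let m i := mu (turn i).
Let sgn (theta : R) i := if turn i == g then - theta else theta.

Let indepY : mutually_independent Y.
Proof.
apply: (mutually_independent_reindex (f := fun i => (turn i, i./2))
  (g := fun z : arm * nat => z.2.*2 + (z.1 == arm2))%N _ hX.2).
move=> i /=; rewrite /turn -[RHS]odd_double_half addnC.
by case: (odd i).
Qed.

Let log_tilt_gap theta n w :
  log_tilt Y m (sgn theta) n.*2 w =
  - theta * (gap n w - n%:R * Delta) - n%:R * theta ^+ 2.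
Proof.
elim: n => [|n IH].
  by rewrite /log_tilt /gap !big_ord0 !mul0r !subr0 mulr0.
rewrite doubleS /log_tilt 2!big_ord_recr /=.
rewrite -/(log_tilt Y m (sgn theta) n.*2 w) IH.
rewrite /gap big_ord_recr/= -[n.+1%:R]natr1 /Y /m /sgn /= uphalf_double doubleK.
have -> : turn n.*2 = arm1 by rewrite /turn odd_double.
have -> : turn n.*2.+1 = arm2 by rewrite /turn /= odd_double.
by case: (armP g) => ->; rewrite /other /=; field.
Qed.

(** [gaussian_maximal] along the interleaved sequence, tilted by - theta on the
    rewards of g and by theta on those of the other arm. *)
Lemma gap_maximal (theta c : R) (N : nat) (A : set Omega) : 0 < c ->
  measurable A ->
  (forall w, A w -> exists2 n, (n <= N)%N &
    c <= expR (- theta * (gap n w - n%:R * Delta) - n%:R * theta ^+ 2)) ->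
  (P A <= (c^-1)%:E)%E.
Proof.
move=> c0 mA Ac.
apply: (gaussian_maximal indepY (m := m) (s := sgn theta) (n := N.*2) _ c0 mA).
  by move=> i B mB; exact: hX.1.
move=> w /Ac[n nN cn]; exists n.*2; first by rewrite leq_double.
by rewrite log_tilt_gap.
Qed.

(** For theta = Delta the drift cancels and the martingale of [gap_maximal] is
    exp (- Delta S_n). *)
Lemma gap_ruin (beta : R) (N : nat) (A : set Omega) : measurable A ->
  (forall w, A w -> exists2 n, (n <= N)%N & gap n w <= - beta) ->
  0 < Delta -> (P A <= (expR (- (Delta * beta)))%:E)%E.
Proof.
move=> mA Ab D0; rewrite expRN.
apply: (gap_maximal (theta := Delta) (N := N) _ mA); first exact: expR_gt0.
move=> w /Ab[n nN gn]; exists n => //; rewrite ler_expR.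
move: gn; set G := gap n w; move: (mu g - mu b) D0 => D D0 gn.
rewrite [leRHS](_ : _ = - (D * G)); last by ring.
by rewrite -mulrN ler_pM2l// lerNr.
Qed.

Lemma gap_chernoff (theta beta : R) (n : nat) (A : set Omega) : measurable A ->
  (forall w, A w -> gap n w <= beta) -> 0 <= theta ->
  (P A <= (expR (theta * beta - n%:R * (theta * (Delta - theta))))%:E)%E.
Proof.
move=> mA Ab t0; rewrite -[X in expR X]opprK expRN.
apply: (gap_maximal (theta := theta) (N := n) _ mA); first exact: expR_gt0.
move=> w /Ab gn; exists n => //; rewrite ler_expR.
move: gn; set G := gap n w; move: (mu g - mu b) => D gn.
rewrite -subr_ge0 [leRHS](_ : _ = theta * (beta - G)); last by ring.
by rewrite mulr_ge0// subr_ge0.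
Qed.

Lemma first_pull_le_half (A : set Omega) : measurable A ->
  (forall w, A w -> X g 0%N w <= X b 0%N w) -> 0 < Delta ->
  (P A <= (2^-1)%:E)%E.
Proof.
move=> mA Ab D0.
have mL : measurable [set w | X g 0%N w <= X b 0%N w].
  have := measurable_fun_ler (measurable_funPT (X g 0%N))
    (measurable_funPT (X b 0%N)).
  by move/(_ measurableT [set true] I); rewrite setTI.
apply: (@le_trans _ _ (P [set w | X g 0%N w <= X b 0%N w])).
  by rewrite le_measure ?inE.
apply: (normal_prob_le_half (m1 := mu g) (m2 := mu b)); first lra.
- by move=> B; exact: hX.1.
- by move=> B; exact: hX.1.
move=> A' B mA' mB.
have := hX.2 [:: (g, 0%N); (b, 0%N)] (fun i => if i.1 == g then A' else B).
rewrite !bigcap_seq !big_cons !big_nil /= eqxx (negbTE (other_neq g)) setIT mule1.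
apply=> [|i]; last by case: ifP.
by rewrite inE xpair_eqE eq_sym (negbTE (other_neq g)).
Qed.

End gap.

(** * Paths of the strategy *)

Section path.
Context (R : realType) (x : arm -> nat -> R) (T : nat) (Delta : R).
Local Notation pi := (sprt_etc T Delta).

(* [emp_mean] and [sprt_test] are read on the reward table; the lemmas below
   show that they agree with what the strategy computes from its history. *)
Definition emp_mean (a : arm) (n : nat) : R := (\sum_(k < n) x a k) / n%:R.

Definition sprt_test (n : nat) : bool :=
  ln (T%:R * Delta ^+ 2) / (n%:R * Delta)
    <= `|emp_mean arm1 n - emp_mean arm2 n|.

Definition explore (t : nat) : history R :=
  mkseq (fun s => (turn s, x (turn s) s./2)) t.

Lemma rewards_of_rcons (a : arm) (h : history R) z :
  rewards_of a (rcons h z) =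
  if z.1 == a then rcons (rewards_of a h) z.2 else rewards_of a h.
Proof. by rewrite /rewards_of filter_rcons; case: ifP; rewrite ?map_rcons. Qed.

Lemma exploreS t : explore t.+1 = rcons (explore t) (turn t, x (turn t) t./2).
Proof. by rewrite /explore mkseqS. Qed.

Lemma rewards_of_explore (a : arm) (t : nat) :
  rewards_of a (explore t) =
  mkseq (x a) (if a == arm1 then uphalf t else t./2).
Proof.
elim: t => [|t IH]; first by rewrite /rewards_of /explore /=; case: ifP.
rewrite exploreS rewards_of_rcons IH /= uphalf_half /turn.
by case: (armP a) => ->; case: (boolP (odd t)) => /= _;
  rewrite ?add0n ?add1n ?mkseqS.
Qed.

Lemma mu_hat_explore (a : arm) (t n : nat) (h : history R) :
  (n <= t./2)%N -> mu_hat a n (explore t ++ h) = emp_mean a n.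
Proof.
move=> nt; rewrite /mu_hat /emp_mean; congr (_ / _); apply: eq_bigr => k _.
have kt : (k < if a == arm1 then uphalf t else t./2)%N.
  have kt2 := leq_trans (ltn_ord k) nt.
  by case: ifP => // _; rewrite uphalf_half; apply: leq_trans kt2 (leq_addl _ _).
have -> : rewards_of a (explore t ++ h) =
    rewards_of a (explore t) ++ rewards_of a h.
  by rewrite /rewards_of filter_cat map_cat.
by rewrite nth_cat rewards_of_explore size_mkseq kt nth_mkseq.
Qed.

Lemma size_play (s : strategy R) (t : nat) : size (play x s t) = t.
Proof. by elim: t => //= t IH; rewrite size_rcons IH. Qed.

Lemma play_prefix (s : strategy R) (t u : nat) :
  exists h, play x s (t + u) = play x s t ++ h.
Proof.
elim: u => [|u [h IH]]; first by exists [::]; rewrite addn0 cats0.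
by rewrite addnS /= IH; eexists; rewrite rcons_cat.
Qed.

Lemma sprt_stops_explore (t n : nat) (h : history R) :
  (n <= t./2)%N -> sprt_stops T Delta (explore t ++ h) n = sprt_test n.
Proof. by move=> nt; rewrite /sprt_stops !mu_hat_explore. Qed.

Lemma play_explore (t : nat) :
  (forall n, (0 < n)%N -> (n <= t.-1./2)%N -> ~~ sprt_test n) ->
  play x pi t = explore t.
Proof.
elim: t => [//|t IH] Hn /=.
rewrite IH => [|n n0 nt]; last first.
  by apply: Hn => //; apply: leq_trans nt _; exact/half_leq/leq_pred.
have -> : pi (explore t) = turn t.
  rewrite /sprt_etc /sprt_tau_half size_mkseq.
  rewrite (_ : [seq n <- _ | _] = [::]) => [|]; last first.
    rewrite -(filter_pred0 (iota 1 t./2)); apply: eq_in_filter => n.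
    rewrite mem_iota add1n ltnS => /andP[n0 nt] /=.
    rewrite -[explore t]cats0 sprt_stops_explore//; apply/negbTE/Hn => //.
  by rewrite /= /turn; case: odd.
rewrite exploreS rewards_of_explore size_mkseq /turn uphalf_half.
by case: (odd t).
Qed.

(** The prefix of length 2m of the history, where m is the first index at which
    the test succeeds, is pure exploration, and it contains all the data on
    which the indices up to m depend; what is played later is invisible to the
    first success. *)
Lemma sprt_tau_play (t : nat) :
  sprt_tau_half T Delta (play x pi t) =
    ohead [seq n <- iota 1 t./2 | sprt_test n] /\
  forall n a, sprt_tau_half T Delta (play x pi t) = Some n ->
    mu_hat a n (play x pi t) = emp_mean a n.
Proof.
rewrite /sprt_tau_half size_play.
have [/hasP[n0]|/hasPn noT] := boolP (has sprt_test (iota 1 t./2)); last first.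
  have -> : play x pi t = explore t ++ [::].
    rewrite cats0; apply: play_explore => n n0 nt; apply: noT.
    rewrite mem_iota n0 add1n ltnS; apply: leq_trans nt _.
    exact/half_leq/leq_pred.
  have e : [seq n <- iota 1 t./2 | sprt_stops T Delta (explore t ++ [::]) n] =
      [seq n <- iota 1 t./2 | sprt_test n].
    apply: eq_in_filter => n; rewrite mem_iota add1n ltnS => /andP[_ nt].
    exact: sprt_stops_explore.
  rewrite e; split=> // n a.
  have -> : [seq n <- iota 1 t./2 | sprt_test n] = [::]; last by [].
  rewrite -(filter_pred0 (iota 1 t./2)); apply: eq_in_filter => k kt.
  exact/negbTE/noT.
rewrite mem_iota add1n ltnS => /andP[n00 n0t] n0test.
pose Q n := (0 < n)%N && sprt_test n.
have exQ : exists n, Q n by exists n0; rewrite /Q n00.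
case: (ex_minnP exQ) => m /andP[m0 mtest] mmin.
have mt : (m <= t./2)%N.
  by apply: leq_trans n0t; apply: mmin; rewrite /Q n00.
have mt2 : (m.*2 <= t)%N.
  by rewrite -[t]odd_double_half (leq_trans _ (leq_addl _ _))// leq_double.
have [h hE] := play_prefix pi m.*2 (t - m.*2).
rewrite subnKC// in hE.
rewrite (@play_explore m.*2) in hE; last first.
  move=> n n_0 nm; apply/negP => ntest.
  have := mmin n; rewrite /Q n_0 ntest => /(_ isT) mn.
  move: (leq_trans mn nm) m0; clear; case: m => // m.
  by rewrite doubleS /= uphalf_double ltnn.
rewrite hE.
have hd (p : pred nat) : (forall n, (n <= m)%N -> p n = sprt_test n) ->
    ohead [seq n <- iota 1 t./2 | p n] = Some m.
  move=> pE; rewrite -(subnKC mt) iotaD filter_cat.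
  have -> : iota 1 m = rcons (iota 1 m.-1) m.
    by rewrite -{1}(prednK m0) -[m.-1.+1]addn1 iotaD cats1 add1n prednK.
  rewrite filter_rcons pE// mtest (_ : [seq n <- iota 1 m.-1 | p n] = [::])//.
  rewrite -(filter_pred0 (iota 1 m.-1)); apply: eq_in_filter => k.
  rewrite mem_iota add1n prednK// => /andP[k0 km].
  rewrite pE; last exact: ltnW.
  by apply/negP => kt; have := mmin k; rewrite /Q k0 kt leqNgt km => /(_ isT).
have halfm : (m.*2)./2 = m by exact: doubleK.
rewrite !hd//; last by move=> n nm; apply: sprt_stops_explore; rewrite halfm.
split=> // n a [<-]; apply: mu_hat_explore; rewrite halfm//.
Qed.

Lemma arm_at_sprt (t : nat) :
  arm_at x pi t.+1 =
  if ohead [seq n <- iota 1 t./2 | sprt_test n] is Some n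
  then [arg max_(a > arm1) emp_mean a n]%O else turn t.
Proof.
rewrite /arm_at /= /sprt_etc size_play.
have [tauE muE] := sprt_tau_play t.
rewrite -tauE; case E : (sprt_tau_half _ _ _) => [n|]; last first.
  by rewrite /= /turn; case: odd.
congr (Order.arg_max _ _ _); apply/funext => a.
exact: muE.
Qed.

End path.

(** * Measurability and decomposition of the regret *)

(** Only finitely many order comparisons decide the argmax, which makes it a
    measurable choice; the value at a tie is a constant left unevaluated. *)
Lemma arg_max_arm (R : realType) (F : arm -> R) :
  [arg max_(a > arm1) F a]%O =
  if F arm1 < F arm2 then arm2 else
  if F arm2 < F arm1 then arm1 else odflt arm1 [pick a : arm | true].
Proof.
case: (ltgtP (F arm1) (F arm2)) => F12.
- case: Order.TotalTheory.arg_maxP => // a _ Fa; case: (armP a) => // aE.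
  by have := Fa arm2 isT; rewrite aE /= leNgt F12.
- case: Order.TotalTheory.arg_maxP => // a _ Fa; case: (armP a) => // aE.
  by have := Fa arm1 isT; rewrite aE /= leNgt F12.
- rewrite /Order.arg_max /extremum; congr odflt; apply: eq_pick => a /=.
  apply/forallP => a'; rewrite /Order.ge /=.
  by case: (armP a) => ->; case: (armP a') => ->; rewrite ?F12 lexx.
Qed.

Lemma arg_max_armP (R : realType) (F : arm -> R) (a a' : arm) :
  [arg max_(a > arm1) F a]%O = a -> F a' <= F a.
Proof. by move=> <-; case: Order.TotalTheory.arg_maxP => // i _ /(_ a' isT). Qed.

Lemma measurable_ohead_filter (d : measure_display) (Omega : measurableType d)
    (s : seq nat) (test : nat -> Omega -> bool) (F : nat -> Omega -> bool)
    (c : bool) :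
  (forall n, measurable_fun setT (test n)) ->
  (forall n, measurable_fun setT (F n)) ->
  measurable_fun setT (fun w =>
    if ohead [seq n <- s | test n w] is Some n then F n w else c).
Proof.
move=> mtest mF; elim: s => [|n s IH]; first exact: measurable_cst.
rewrite (_ : (fun w => _) = fun w => if test n w then F n w else
    if ohead [seq n <- s | test n w] is Some n then F n w else c).
  exact: measurable_fun_ifT.
by apply/funext => w /=; case: (test n w).
Qed.

Section bandit.
Context (d : measure_display) (Omega : measurableType d) (R : realType)
  (P : probability Omega R) (mu : arm -> R) (X : arm -> nat -> {RV P >-> R}).
Variables (T : nat) (Delta : R).
Local Notation rw w := (fun a k => X a k w).

Lemma measurable_emp_mean a n :
  measurable_fun setT (fun w => emp_mean (rw w) a n).
Proof.
by apply: measurable_funM => //; apply: measurable_sum => k.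
Qed.

Lemma measurable_sprt_test n :
  measurable_fun setT (fun w => sprt_test (rw w) T Delta n).
Proof.
apply: measurable_fun_ler => //; apply: measurableT_comp => //.
by apply: measurable_funB; exact: measurable_emp_mean.
Qed.

Lemma measurable_bool_set (f : Omega -> bool) :
  measurable_fun setT f -> measurable [set w | f w].
Proof. by move=> /(_ measurableT [set true] I); rewrite setTI. Qed.

Lemma measurable_arm_at_sprt a t :
  measurable [set w | arm_at (rw w) (sprt_etc T Delta) t.+1 = a].
Proof.
rewrite (_ : [set w | _] = [set w | is_true
    (if ohead [seq n <- iota 1 t./2 | sprt_test (rw w) T Delta n] is Some n
    then [arg max_(a > arm1) emp_mean (rw w) a n]%O == a else turn t == a)]).
  apply: measurable_bool_set; apply: measurable_ohead_filter => n.
    exact: measurable_sprt_test.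
  under eq_fun do rewrite arg_max_arm.
  have mem a1 a2 : measurable_fun setT (fun w =>
      emp_mean (rw w) a1 n < emp_mean (rw w) a2 n).
    by apply: measurable_fun_ltr; exact: measurable_emp_mean.
  rewrite (_ : (fun w => _) = fun w =>
      if emp_mean (rw w) arm1 n < emp_mean (rw w) arm2 n then arm2 == a else
      if emp_mean (rw w) arm2 n < emp_mean (rw w) arm1 n then arm1 == a else
      odflt arm1 [pick a : arm | true] == a).
    by apply: measurable_fun_ifT => //; apply: measurable_fun_ifT.
  by apply/funext => w; do 2 case: ifP => // _.
by apply/seteqP; split => w /=; rewrite arm_at_sprt; case: ohead => [n|] => /eqP.
Qed.

Lemma sprt_test_gap (g : arm) n w : (0 < n)%N ->
  sprt_test (rw w) T Delta n =
  (ln (T%:R * Delta ^+ 2) / Delta <= `|gap X g n w|).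
Proof.
move=> n0; have nR : 0 < n%:R :> R by rewrite ltr0n.
rewrite /sprt_test.
have -> : `|emp_mean (rw w) arm1 n - emp_mean (rw w) arm2 n| =
    `|gap X g n w| / n%:R.
  rewrite /emp_mean -mulrBl normrM (gtr0_norm (_ : 0 < n%:R^-1)) ?invr_gt0//.
  rewrite /gap big_split /= sumrN; congr (_ / _).
  by case: (armP g) => ->//; rewrite distrC.
by rewrite invfM mulrCA mulrC ler_pM2r// invr_gt0.
Qed.

Lemma emp_mean_gap (g : arm) n w : (0 < n)%N ->
  (emp_mean (rw w) g n <= emp_mean (rw w) (other g) n) = (gap X g n w <= 0).
Proof.
move=> n0; have nR : 0 < n%:R :> R by rewrite ltr0n.
by rewrite /emp_mean ler_pM2r ?invr_gt0// /gap big_split /= sumrN subr_le0.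
Qed.

Lemma regret_pulls (pi : strategy R) (g : arm) :
  mu (other g) <= mu g ->
  (forall t, measurable [set w | arm_at (rw w) pi t.+1 = other g]) ->
  regret mu X pi T =
  ((mu g - mu (other g)) *
    \sum_(t < T) fine (P [set w | arm_at (rw w) pi t.+1 = other g]))%:E.
Proof.
move=> mug mB; set B := fun t => [set w | arm_at (rw w) pi t.+1 = other g].
have maxE : Num.max (mu arm1) (mu arm2) = mu g.
  case: (armP g) mug => ->; rewrite /other /= => ?.
    exact/max_idPl.
  exact/max_idPr.
set D := mu g - mu (other g).
have LB t : \1_(B t) \in Lfun P 1.
  by apply/Lfun1_integrable; exact: integrable_indic (mB t).
have fE : (fun w => \sum_(1 <= t < T.+1) mu (arm_at (rw w) pi t)) =
    (cst (T%:R * mu g) \- (D \o* (fun w => \sum_(t < T) \1_(B t) w))).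
  apply/funext => w /=; rewrite big_add1 /= big_mkord.
  rewrite mulr_suml -[T in T%:R]card_ord -sumr_const mulr_suml -sumrB.
  apply: eq_bigr => t _; rewrite mul1r indicE.
  have [Bw|Bw] := boolP (w \in B t).
    by rewrite mul1r (set_mem Bw) /D; ring.
  rewrite mul0r subr0; congr mu.
  have : arm_at (rw w) pi t.+1 != other g.
    by apply: contraNneq Bw => ?; apply: mem_set.
  by rewrite arm_other negbK => /eqP.
have Ls : (fun w => \sum_(t < T) \1_(B t) w) \in Lfun P 1.
  rewrite (_ : (fun w => _) = \sum_(t < T) \1_(B t)).
    by apply: rpred_sum => t _.
  by apply/funext => w; rewrite fct_sumE.
have LDs : (D \o* (fun w => \sum_(t < T) \1_(B t) w)) \in Lfun P 1.
  exact: Lfun_scale.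
have Es : ('E_P[fun w => (\sum_(t < T) \1_(B t) w)%R] =
    (\sum_(t < T) fine (P (B t)))%R%:E)%E.
  rewrite unlock; under eq_integral do rewrite -sumEFin.
  rewrite ge0_integral_sum//; last first.
    by move=> t; apply/measurable_EFinP; apply: measurable_indic; exact: mB.
  rewrite -sumEFin; apply: eq_bigr => t _.
  have mBt : measurable (B t) := mB t.
  by rewrite integral_indic// setIT fineK// fin_num_measure.
rewrite /regret fE (expectationB (Lfun_cst _ _ _) LDs) (expectationZl D Ls) Es.
rewrite expectation_cst maxE.
by rewrite -EFinM -!EFinB; congr EFin; ring.
Qed.

End bandit.

(** Among the rounds 2k+1 and 2k+2, exactly one is the turn of a. *)
Lemma sum_turn (R : numDomainType) (a : arm) (q : nat -> R) (N : nat) :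
  (forall k, 0 <= q k) ->
  \sum_(t < N) (if turn t == a then q t./2 else 0) <= \sum_(k < N) q k.
Proof.
move=> q0.
have -> : \sum_(k < N) q k = \sum_(t < N.*2) (if turn t == a then q t./2 else 0).
  elim: N => [|n IH]; first by rewrite !big_ord0.
  rewrite doubleS big_ord_recr IH !big_ord_recr /= uphalf_double doubleK.
  by rewrite turn_double; case: eqP => _ /=; rewrite ?addr0.
rewrite -!(big_mkord xpredT (fun t => if turn t == a then q t./2 else 0)).
rewrite (big_cat_nat (n := N) (p := N.*2))//=; last by rewrite -addnn leq_addl.
by rewrite lerDl sumr_ge0// => t _; case: ifP.
Qed.

Lemma ohead_filter_some (p : pred nat) (k n : nat) :
  ohead [seq i <- iota 1 k | p i] = Some n -> [/\ (0 < n)%N, (n <= k)%N & p n].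
Proof.
move=> h; have : n \in [seq i <- iota 1 k | p i].
  by case: [seq _ <- _ | _] h => //= a l [->]; rewrite mem_head.
by rewrite mem_filter mem_iota add1n ltnS => /and3P[].
Qed.

Lemma ohead_filter_none (p : pred nat) (k n : nat) :
  ohead [seq i <- iota 1 k | p i] = None -> (0 < n)%N -> (n <= k)%N -> ~~ p n.
Proof.
move=> h n0 nk; apply/negP => pn.
have : n \in [seq i <- iota 1 k | p i].
  by rewrite mem_filter pn mem_iota n0 add1n ltnS.
by case: [seq _ <- _ | _] h.
Qed.

Section regret_split.
Context (d : measure_display) (Omega : measurableType d) (R : realType)
  (P : probability Omega R) (mu : arm -> R) (X : arm -> nat -> {RV P >-> R}).
Variables (T : nat) (Delta : R) (g : arm).
Local Notation rw w := (fun a k => X a k w).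
Local Notation b := (other g).

(** q k bounds the probability that the test is still running after n = k, and r
    the probability that it has elected the wrong arm.  While the test runs,
    the inferior arm is pulled in one round out of two; after it has stopped,
    only if it was elected. *)
Lemma regret_sprt_le (q : nat -> R) (r : R) :
  mu b <= mu g -> (forall k, 0 <= q k) -> 0 <= r ->
  (forall k A, measurable A ->
    (forall w, A w -> forall n, (0 < n)%N -> (n <= k)%N ->
      ~~ sprt_test (rw w) T Delta n) -> (P A <= (q k)%:E)%E) ->
  (forall k A, measurable A ->
    (forall w, A w -> exists2 n,
      ohead [seq n <- iota 1 k | sprt_test (rw w) T Delta n] = Some n &
      emp_mean (rw w) g n <= emp_mean (rw w) b n) -> (P A <= r%:E)%E) ->
  (regret mu X (sprt_etc T Delta) T <=
   ((mu g - mu b) * (\sum_(k < T) q k + T%:R * r))%:E)%E.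
Proof.
move=> mug q0 r0 hq hr.
have mB t := measurable_arm_at_sprt X T Delta b t.
rewrite (regret_pulls T mug mB) lee_fin ler_wpM2l ?subr_ge0//.
apply: (@le_trans _ _
  (\sum_(t < T) ((if turn t == b then q t./2 else 0) + r))); last first.
  by rewrite big_split /= sumr_const card_ord mulr_natl lerD2r sum_turn.
apply: ler_sum => t _.
set B := [set w | _].
have mBt : measurable B := mB t.
rewrite -lee_fin (fineK (fin_num_measure P _ mBt)).
pose tau w := ohead [seq n <- iota 1 t./2 | sprt_test (rw w) T Delta n].
pose E := [set w | is_true (if tau w is Some n then false else true)].
have mE : measurable E.
  by apply: measurable_bool_set; apply: measurable_ohead_filter => n //;
    exact: measurable_sprt_test.
rewrite -(setUIDK B E) (le_trans (measureU2 _ _ _))//;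
  [exact: measurableI|exact: measurableD|].
rewrite EFinD leeD//.
- case: ifP => tb.
    apply: hq; first exact: measurableI.
    move=> w [_ +] n n0 nk; rewrite /E/= /tau.
    by case Eo : ohead => // _; apply: ohead_filter_none Eo n0 nk.
  rewrite (_ : B `&` E = set0) ?measure0//.
  apply/seteqP; split => w // -[]; rewrite /B /E /= /tau arm_at_sprt.
  by case: ohead => // /eqP; rewrite tb.
- apply: hr; first exact: measurableD.
  move=> w []; rewrite /B /E /= /tau arm_at_sprt.
  case Eo : ohead => [n|] => [Bw _|_ /(_ isT)//]; exists n; first exact: Eo.
  exact: arg_max_armP Bw.
Qed.

End regret_split.

(** * Numerical estimates *)

(** The sum of a nonincreasing function over k >= 1 is below its integral over
    the positive reals, here t0 + 1 / kappa. *)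
Lemma sum_min1_expR_le (R : realType) (kappa t0 : R) (N : nat) :
  0 < kappa -> 0 <= t0 ->
  \sum_(k < N) Num.min 1 (expR (kappa * (t0 - k%:R))) <= 1 + (t0 + kappa^-1).
Proof.
move=> k0 t00.
(* G t is the integral of the summand over the half-line from t on. *)
pose G (t : R) := if t <= t0 then t0 - t + kappa^-1
                  else expR (kappa * (t0 - t)) / kappa.
have ki0 : 0 < kappa^-1 by rewrite invr_gt0.
have kik : kappa^-1 * kappa = 1 by rewrite mulVf ?gt_eqF.
have G0 t : 0 <= G t.
  rewrite /G; case: ifP => tt; first lra.
  by rewrite mulr_ge0 ?expR_ge0// ltW.
have step (t : R) : Num.min 1 (expR (kappa * (t0 - (t + 1)))) <= G t - G (t + 1).
  have [t1|t1] := leP (t + 1) t0.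
    have tt : t <= t0 by lra.
    have : Num.min 1 (expR (kappa * (t0 - (t + 1)))) <= 1 by rewrite ge_min lexx.
    by rewrite /G t1 tt; lra.
  rewrite ge_min; apply/orP; right.
  rewrite /G (lt_geF t1).
  set e := expR (kappa * (t0 - (t + 1))).
  have e0 : 0 < e by exact: expR_gt0.
  have [tt|tt] := leP t t0.
    have e1 : e <= 1.
      rewrite /e -[leRHS]expR0 ler_expR.
      have : 0 <= kappa * (t + 1 - t0) by apply: mulr_ge0; lra.
      by lra.
    have hz : e * (1 + kappa * (t + 1 - t0)) <= 1.
      rewrite -[leRHS](expRxMexpNx_1 (kappa * (t0 - (t + 1)))) -/e ler_pM2l//.
      apply: le_trans (expR_ge1Dx _).
      by rewrite le_eqVlt; apply/orP; left; apply/eqP; ring.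
    have hk : kappa^-1 * (e * (1 + kappa * (t + 1 - t0))) <= kappa^-1.
      by rewrite -[leRHS]mulr1 ler_pM2l.
    have : kappa^-1 * (e * (1 + kappa * (t + 1 - t0))) =
      kappa^-1 * e + (kappa^-1 * kappa) * (e * (t + 1 - t0)) by ring.
    rewrite kik mul1r => E.
    have : 0 <= (t0 - t) * (1 - e) by apply: mulr_ge0; lra.
    move: hk; rewrite E; lra.
  have -> : expR (kappa * (t0 - t)) = e * expR kappa.
    by rewrite /e -expRD; congr expR; ring.
  have hk : e * (1 + kappa) <= e * expR kappa by rewrite ler_pM2l// expR_ge1Dx.
  rewrite -mulrBl ler_pdivlMr//; lra.
case: N => [|N]; first by rewrite big_ord0; lra.
suff : \sum_(k < N.+1) Num.min 1 (expR (kappa * (t0 - k%:R))) <= 1 + G 0 - G N%:R.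
  by move: (G0 N%:R); rewrite {2}/G t00 subr0; lra.
elim: N => [|N IH].
  rewrite big_ord_recr big_ord0 /=.
  have : Num.min 1 (expR (kappa * (t0 - 0%:R))) <= 1 by rewrite ge_min lexx.
  by lra.
by rewrite big_ord_recr /= -[N.+1%:R]natr1; have := step N%:R; lra.
Qed.

(** With v ^+ 2 = L + 1, so that (v ^+ 2 - 1) / Delta is the threshold
    L / Delta, this theta is the minimizer of t0 + kappa^-1. *)
Lemma chernoff_optimum (R : realType) (Delta v : R) : 0 < Delta -> 1 <= v ->
  let theta := Delta / (1 + v) in
  let kappa := theta * (Delta - theta) in
  let t0 := (theta * ((v ^+ 2 - 1) / Delta)) / kappa in
  [/\ 0 < kappa, 0 <= t0 & t0 + kappa^-1 = (1 + v) ^+ 2 / Delta ^+ 2].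
Proof.
move=> D0 v1 /=.
have v0 : 0 < v by lra.
have v10 : 0 < 1 + v by lra.
set theta := Delta / (1 + v).
have th0 : 0 < theta by rewrite divr_gt0.
have kE : theta * (Delta - theta) = Delta ^+ 2 * v / (1 + v) ^+ 2.
  by rewrite /theta; field; rewrite gt_eqF.
have k0 : 0 < theta * (Delta - theta).
  by rewrite kE divr_gt0 ?mulr_gt0 ?exprn_gt0.
split=> //.
  rewrite divr_ge0 ?(ltW k0)// mulr_ge0 ?(ltW th0)// divr_ge0 ?(ltW D0)//.
  nra.
by rewrite kE /theta; field; rewrite !gt_eqF.
Qed.

Lemma sqrt_log_bound (R : realType) (L : R) : 0 <= L ->
  1 + Num.sqrt (L + 1) ^+ 2 + 2 * Num.sqrt (L + 1) + 1 <=
  (1 + L) + (4 * Num.sqrt L + 4).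
Proof.
move=> L0; have L10 : 0 <= L + 1 by lra.
have := sqr_sqrtr L0; have := sqr_sqrtr L10.
have := sqrtr_ge0 L; have := sqrtr_ge0 (L + 1).
move: (Num.sqrt L) (Num.sqrt (L + 1)) => s v v0 s0 vE sE.
have : v <= s + 1 by nra.
nra.
Qed.

(** The numerator in the bound of [regret_sprt_log] is compared with
    Delta sqrt T = sqrt x = exp (L / 2), where L = v ^+ 2 - 1. *)
Lemma regret_profile_le5 (R : realType) (v : R) : 1 <= v ->
  (1 + v) ^+ 2 + 1 <= 5 * expR ((v ^+ 2 - 1) / 2).
Proof.
move=> v1; have := expR_ge1Dx ((v ^+ 2 - 1) / 2); nra.
Qed.

Lemma ten_div_sqrt_e (R : realType) (N : R) : 0 < N ->
  5 * Num.sqrt N < 10 * Num.sqrt (N / expR 1).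
Proof.
move=> N0; rewrite sqrtrM ?ltW// sqrtrV ?expR_ge0//.
set s := Num.sqrt (expR 1).
have s0 : 0 < s by rewrite sqrtr_gt0 expR_gt0.
have sN : 0 < Num.sqrt N by rewrite sqrtr_gt0.
have s2 : s < 2.
  have q2 : 2^-1 < expR (- 2^-1) :> R.
    have := @expR_gt1Dx R (- 2^-1); rewrite oppr_eq0 invr_eq0 pnatr_eq0 => /(_ isT).
    lra.
  have sq : s ^+ 2 * expR (- 2^-1) ^+ 2 = 1.
    rewrite sqr_sqrtr ?expR_ge0// -expRM_natl -expRD -[RHS]expR0; congr expR.
    by field.
  have sq1 : (s * expR (- 2^-1)) ^+ 2 = 1 by rewrite exprMn.
  have : s * expR (- 2^-1) <= 1.
    by rewrite -(expr_le1 (n := 2))// ?sq1// mulr_ge0 ?expR_ge0// ltW.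
  nra.
rewrite mulrA ltr_pdivlMr//; nra.
Qed.

(** * Regret bounds *)

Section main.
Context (d : measure_display) (Omega : measurableType d) (R : realType)
  (P : probability Omega R) (mu : arm -> R) (X : arm -> nat -> {RV P >-> R}).
Variables (T : nat) (Delta : R) (g : arm).
Hypotheses (hX : gaussian_rewards mu X) (D0 : 0 < Delta)
  (hg : mu g - mu (other g) = Delta) (T0 : (0 < T)%N).
Local Notation x := (T%:R * Delta ^+ 2).
Local Notation Reg := (regret mu X (sprt_etc T Delta) T).

Let mug : mu (other g) <= mu g.
Proof. by rewrite -subr_ge0 hg ltW. Qed.

Let x0 : 0 < x.
Proof. by rewrite mulr_gt0 ?exprn_gt0// ltr0n. Qed.

(** The inferior arm is pulled at most 1 + (1 + v)^2 / Delta^2 times on average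
    during exploration, at the cost Delta each; wrong elections cost
    1 / Delta. *)
Lemma regret_sprt_log (v := Num.sqrt (ln x + 1)) : 1 <= x ->
  (Reg <= (Delta + ((1 + v) ^+ 2 + 1) / Delta)%:E)%E.
Proof.
move=> x1; have L0 : 0 <= ln x by exact: ln_ge0.
have vE : v ^+ 2 = ln x + 1 by rewrite sqr_sqrtr// addr_ge0.
have v1 : 1 <= v by rewrite -[leLHS]sqrtr1 ler_wsqrtr//; lra.
have [] := chernoff_optimum D0 v1.
set theta := Delta / (1 + v); set kappa := theta * (Delta - theta).
have th0 : 0 <= theta by rewrite divr_ge0 ?ltW// ltr_pwDl// (le_trans ler01).
have -> : v ^+ 2 - 1 = ln x by rewrite vE; ring.
set beta := ln x / Delta; set t0 := theta * beta / kappa => k0 t00 sumE.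
have beta0 : 0 <= beta by rewrite divr_ge0// ltW.
pose q (k : nat) := Num.min 1 (expR (kappa * (t0 - k%:R))).
have key : (Reg <= ((mu g - mu (other g)) *
    (\sum_(k < T) q k + T%:R * x^-1))%:E)%E.
  apply: regret_sprt_le => //.
  - by move=> k; rewrite /q le_min ler01 expR_ge0.
  - by rewrite invr_ge0 ltW.
  - move=> k A mA noA; rewrite /q EFin_min le_min probability_le1//=.
    rewrite (_ : kappa * (t0 - k%:R) = theta * beta -
      k%:R * (theta * (mu g - mu (other g) - theta))); last first.
      by rewrite hg -/kappa /t0; field; rewrite gt_eqF.
    apply: (gap_chernoff hX mA _ th0) => w /noA {}noA.
    (* At k = 0 the walk is at 0, which is at most beta as L >= 0. *)
    case: k noA => [|k] noA; first by rewrite /gap big_ord0.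
    have := noA k.+1 isT (leqnn _).
    rewrite (sprt_test_gap X T Delta g w (ltn0Sn k)) -ltNge => /ltW.
    by apply: le_trans; exact: ler_norm.
  - move=> k A mA wA.
    rewrite -[x in x^-1](lnK (_ : x \is Num.pos))// -expRN.
    rewrite (_ : ln x = (mu g - mu (other g)) * beta); last first.
      by rewrite hg [RHS]mulrC divfK// gt_eqF.
    apply: (gap_ruin hX (N := k) mA); last by rewrite hg.
    move=> w /wA[n /ohead_filter_some[n0 nk tn] ng]; exists n => //.
    move: tn ng; rewrite (sprt_test_gap X T Delta g w n0) (emp_mean_gap X g w n0).
    by move=> tn /ler0_norm gn; move: tn; rewrite gn lerNr.
apply: (le_trans key); rewrite lee_fin hg.
apply: (@le_trans _ _
  (Delta * ((1 + (1 + v) ^+ 2 / Delta ^+ 2) + T%:R * x^-1))).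
  rewrite ler_pM2l// lerD2r -sumE; exact: sum_min1_expR_le.
rewrite le_eqVlt; apply/orP; left; apply/eqP; field.
by rewrite !gt_eqF// ltr0n.
Qed.

Lemma regret_sprt_small : x < 1 -> (Reg <= (T%:R * Delta / 2 + Delta)%:E)%E.
Proof.
move=> x1; have L0 : ln x < 0 by rewrite ln_lt0// x0.
have test1 w n : (0 < n)%N -> sprt_test (fun a k => X a k w) T Delta n.
  move=> n0; rewrite (sprt_test_gap X T Delta g w n0).
  by rewrite (le_trans _ (normr_ge0 _))// pmulr_lle0 ?invr_gt0// ltW.
pose q (k : nat) : R := (k == 0)%:R.
have key : (Reg <= ((mu g - mu (other g)) *
    (\sum_(k < T) q k + T%:R * 2^-1))%:E)%E.
  apply: regret_sprt_le => //.
  - move=> [|k] A mA noA; first by rewrite /q probability_le1.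
    rewrite (_ : A = set0) ?measure0//; apply/seteqP; split => // w /noA.
    by move=> /(_ 1%N isT isT); rewrite test1.
  - move=> k A mA wA; apply: (first_pull_le_half hX mA _ (g := g)); last by rewrite hg.
    move=> w /wA[n + ng]; case: k {wA} => [//|k] /=; rewrite test1//= => -[n1].
    move: ng; rewrite -n1 (emp_mean_gap X g w (ltn0Sn 0)) /gap big_ord1.
    by rewrite subr_le0.
apply: (le_trans key); rewrite lee_fin hg.
have -> : \sum_(k < T) q k = 1.
  by rewrite -(prednK T0) big_ord_recl big1 ?addr0.
lra.
Qed.

Lemma regret_sprt_bounds :
  [/\ 1 <= x ->
        (Reg <= (ln (expR 1 * x) / Delta
                 + (4 * Num.sqrt (ln x) + 4) / Delta + Delta)%:E)%E,
      x < 1 ->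
        (Reg <= (T%:R * Delta / 2 + Delta)%:E)%E
    & (Reg < (10 * Num.sqrt (T%:R / expR 1) + Delta)%:E)%E].
Proof.
have TR : 0 < T%:R :> R by rewrite ltr0n.
have sx : Num.sqrt x = Num.sqrt T%:R * Delta.
  by rewrite sqrtrM ?ltW// sqrtr_sqr gtr0_norm.
split; [move=> x1|exact: regret_sprt_small|].
- apply: (le_trans (regret_sprt_log x1)); rewrite lee_fin.
  have L0 : 0 <= ln x by exact: ln_ge0.
  have -> : ln (expR 1 * x) = 1 + ln x by rewrite lnM ?posrE ?expR_gt0// expRK.
  rewrite -mulrDl addrC lerD2r ler_pM2r ?invr_gt0//.
  by have := sqrt_log_bound L0; lra.
have := ten_div_sqrt_e TR => sT.
have [x1|x1] := leP 1 x.
  apply: (le_lt_trans (regret_sprt_log x1)); rewrite lte_fin addrC ltrD2r.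
  apply: le_lt_trans sT; rewrite ler_pdivrMr// -mulrA -sx.
  have L0 : 0 <= ln x by exact: ln_ge0.
  have v1 : 1 <= Num.sqrt (ln x + 1) by rewrite -[leLHS]sqrtr1 ler_wsqrtr//; lra.
  apply: (le_trans (regret_profile_le5 v1)).
  rewrite ler_pM2l// sqr_sqrtr ?addr_ge0// addrK.
  suff -> : Num.sqrt x = expR (ln x / 2) by [].
  rewrite -[x in LHS]lnK ?posrE// [ln x in LHS](_ : _ = 2%:R * (ln x / 2)); last first.
    by field.
  by rewrite expRM_natl sqrtr_sqr ger0_norm ?expR_ge0.
apply: (le_lt_trans (regret_sprt_small x1)); rewrite lte_fin ltrD2r.
apply: le_lt_trans sT.
have sT0 := sqrtr_ge0 (T%:R : R).
have : Num.sqrt T%:R * Delta <= 1.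
  by rewrite -sx -[leRHS]sqrtr1 ler_wsqrtr// ltW.
have := sqr_sqrtr (ltW TR); move: (Num.sqrt _) sT0 => s s0 <- sD.
nra.
Qed.

End main.

Theorem theorem2 (R : realType) (d : measure_display)
    (Omega : measurableType d) (P : probability Omega R)
    (mu : arm -> R) (X : arm -> nat -> {RV P >-> R})
    (T : nat) (Delta : R)
    (hX : gaussian_rewards mu X)
    (hDelta : 0 < Delta)
    (hmu : `|mu arm1 - mu arm2| = Delta)
    (hT : (1 <= T)%N) :
  let x := T%:R * Delta ^+ 2 in
  let Reg := regret mu X (sprt_etc T Delta) T in
  [/\ 1 <= x ->
        (Reg <= (ln (expR 1 * x) / Delta
                 + (4 * Num.sqrt (ln x) + 4) / Delta + Delta)%:E)%E,
      x < 1 ->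
        (Reg <= (T%:R * Delta / 2 + Delta)%:E)%E
    & (Reg < (10 * Num.sqrt (T%:R / expR 1) + Delta)%:E)%E].
Proof.
have [g hg] : exists g, mu g - mu (other g) = Delta.
  have [m12|m12] := leP 0 (mu arm1 - mu arm2).
    by exists arm1; rewrite -hmu ger0_norm.
  by exists arm2; rewrite -hmu ltr0_norm// opprB.
exact: (regret_sprt_bounds hX hDelta hg hT).
Qed.
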